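(* Let $E$ and $F$ be Banach spaces over the same scalar field ($\mathbb{R}$ or $\mathbb{C}$), let $0<p<\infty$, let $f\colon E\longrightarrow F$ be an arbitrary mapping (no linearity, continuity or other condition is assumed), and let $a\in E$. Then $f$ is absolutely $p$-summing at $a$ if and only if there are a constant $C>0$ and a regular Borel probability measure $\mu$ on $B_{E'}$ (endowed with the weak* topology) such that $$\left\Vert f(a+x)-f(a)\right\Vert \leq C\left(\int_{B_{E'}}|\varphi(x)|^{p}\,d\mu(\varphi)\right)^{1/p}$$ for all $x\in E$.
   Context: $E'$ denotes the topological dual of $E$ and $B_{E'}$ its closed unit ball, considered as a compact Hausdorff space with the weak* topology. An arbitrary mapping $f\colon E\longrightarrow F$ between Banach spaces is absolutely $p$-summing at $a\in E$ if there is a $C\geq 0$ such that $$\sum_{j=1}^{m}\left\Vert f(a+x_{j})-f(a)\right\Vert^{p}\leq C\sup_{\varphi\in B_{E'}}\sum_{j=1}^{m}|\varphi(x_{j})|^{p}$$ for every natural number $m\geq 1$ and every $x_{1},\ldots,x_{m}\in E$. *)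

(* Defs.v *)
From HB Require Import structures.
From mathcomp Require Import all_boot all_order all_algebra.
From mathcomp Require Import all_classical all_reals all_analysis.
From mathcomp.real_closed Require Import complex.

Set Implicit Arguments.
Unset Strict Implicit.
Unset Printing Implicit Defensive.

Import Order.TTheory GRing.Theory Num.Theory.
Import numFieldNormedType.Exports.

Local Open Scope classical_set_scope.
Local Open Scope ring_scope.

Variant scalar_kind := RealScalars | ComplexScalars.

Definition scalars (R : realType) (k : scalar_kind) : numFieldType :=
  match k with
  | RealScalars => R
  | ComplexScalars => R[i]
  end.

Definition scalar_re (R : realType) (k : scalar_kind) : scalars R k -> R :=
  match k return scalars R k -> R with
  | RealScalars => fun x => x
  | ComplexScalars => fun z => complex.Re z
  end.

(* In a normed module over K the norm is K-valued; as an element of K it is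
   real (nonnegative), so over the complex field nothing is lost by keeping
   only its real part. *)
Definition rnorm (R : realType) (k : scalar_kind)
  (V : normedModType (scalars R k)) (v : V) : R := scalar_re `|v|.

Section DualBall.
Context (R : realType) (k : scalar_kind).
Local Notation K := (scalars R k).
Context (E : completeNormedModType K).

Definition topological_dual : set (E -> K^o) :=
  [set phi | linear phi /\ continuous phi].

Definition dual_norm (phi : E -> K^o) : \bar R :=
  ereal_sup [set (rnorm (phi x))%:E | x in [set x : E | rnorm x <= 1]].

(* {ptws E -> K^o} carries the topology of pointwise convergence, i.e. the
   coarsest one making all evaluations continuous; its trace on the dual is the
   weak-* topology. *)
Definition dual_ball : set {ptws E -> K^o} :=
  [set phi | topological_dual phi /\ (dual_norm phi <= 1)%E].

Definition weakstar_ball : Type := set_type dual_ball.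

HB.instance Definition _ := Topological.on weakstar_ball.

Lemma scalar_re0 : scalar_re (0 : K) = 0.
Proof. by rewrite /scalar_re; case: k. Qed.

Lemma dual_ball0 : dual_ball (fun=> 0).
Proof.
split; first split.
- by move=> c x y; rewrite /= scaler0 addr0.
- exact: cst_continuous.
- apply: ge_ereal_sup => _ [x _ <-].
  by rewrite /rnorm normr0 scalar_re0 lee_fin ler01.
Qed.

HB.instance Definition _ := isPointed.Build weakstar_ball
  (SigSub (mem_set dual_ball0)).

Definition dual_eval (phi : weakstar_ball) (x : E) : K^o := set_val phi x.

End DualBall.

Notation weakstar_borel E := (g_sigma_algebraType (@open (weakstar_ball E))).

Definition regular_borel (R : realType) (k : scalar_kind)
    (E : completeNormedModType (scalars R k))
    (mu : set (weakstar_borel E) -> \bar R) :=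
  forall A : set (weakstar_borel E), measurable A ->
    mu A = ereal_inf [set mu U | U in
             [set U : set (weakstar_ball E) | open U /\ A `<=` U]] /\
    mu A = ereal_sup [set mu Q | Q in
             [set Q : set (weakstar_ball E) | compact Q /\ Q `<=` A]].

Definition absolutely_summing_at (R : realType) (k : scalar_kind)
    (E F : completeNormedModType (scalars R k)) (p : R) (f : E -> F) (a : E) :=
  exists2 C : R, 0 <= C &
  forall (m : nat) (x : 'I_m -> E), (1 <= m)%N ->
    ((\sum_(j < m) rnorm (f (a + x j) - f a) `^ p)%:E <=
     C%:E * ereal_sup [set (\sum_(j < m) rnorm (dual_eval phi (x j)) `^ p)%:E
                      | phi in [set: weakstar_ball E]])%E.

(* Main.v *)
Require Import Defs.
From HB Require Import structures.
From mathcomp Require Import all_boot all_order all_algebra.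
From mathcomp Require Import all_classical all_reals all_analysis.
From mathcomp Require Import finmap lra measurable_realfun.
From mathcomp.real_closed Require Import complex.

Import Order.TTheory GRing.Theory Num.Theory.
Import numFieldNormedType.Exports.

Local Open Scope classical_set_scope.
Local Open Scope ring_scope.

(** A domination by one measure implies the summing inequality because the
    integral of a sum against a probability is at most its supremum. The
    converse is a separation argument. Write [g_x phi = |phi x| ^ p] and let
    [c_x] be [|f (a + x) - f a| ^ p] divided by the summing constant. The
    hypothesis says that every finite sum of functions [g_x] has a supremum over
    the dual ball that is at least the corresponding sum of the [c_x]. As
    points may be repeated in these sums, the same holds for combinations with
    rational, hence with real nonnegative coefficients ([repeat_approx]); no
    property of [f] enters. The supremum is a sublinear functional on bounded
    functions, and the theorem of Mazur and Orlicz ([mazur_orlicz]) provides a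
    linear functional [L] below it with [c_x <= L g_x] for all [x].

    It remains to represent [L] by a measure. The set function
    [A |-> L \1_A] is a finitely additive probability on all subsets
    ([dominating_content]). The dual ball being compact and Hausdorff for the
    weak* topology ([compact_weakstar_ball], [hausdorff_weakstar_ball]), the
    construction of a measure from a content yields a regular Borel probability
    that is at least as large on closed sets ([content_regular_probability]).
    The level sets [g_x >= j / n], for [j >= 1], are closed, and the sum of their
    indicators divided by [n] is within [1 / n] of [g_x]. Hence the integral of
    [g_x] is at least [L g_x], up to [1 / n] ([le_integral_of_level_sets]). *)

(** * The theorem of Mazur and Orlicz *)

Section MazurOrlicz.
Context {R : realType} {V : lmodType R}.
Implicit Types (p q : V -> R) (u v : V) (W : set (V * R)).

(** Homogeneity is asked as an inequality: applied to [t] and to [t^-1], it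
    gives the equality. *)
Definition sublinear p :=
  (forall u v, p (u + v) <= p u + p v) /\
  (forall t u, 0 < t -> p (t *: u) <= t * p u).

Definition convex_cone W :=
  [/\ W (0, 0),
      forall z z', W z -> W z' -> W (z.1 + z'.1, z.2 + z'.2) &
      forall t z, 0 < t -> W z -> W (t *: z.1, t * z.2)].

Lemma sublinearZ p t u : sublinear p -> 0 < t -> p (t *: u) = t * p u.
Proof.
move=> [_ pZ] t0; apply/eqP; rewrite eq_le pZ//=.
rewrite -ler_pdivlMl//; apply: le_trans (pZ _ _ _); last by rewrite invr_gt0.
by rewrite scalerA mulVf ?scale1r// gt_eqF.
Qed.

Lemma sublinear0 p : sublinear p -> p 0 = 0.
Proof.
by move=> sp; have := sublinearZ p 2 0 sp (ltr0Sn _ _); rewrite scaler0; lra.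
Qed.

Lemma sublinearN p u : sublinear p -> - p (- u) <= p u.
Proof.
move=> sp; have [pD _] := sp.
by have := pD u (- u); rewrite subrr sublinear0//; lra.
Qed.

(** The largest sublinear functional below [p] whose value at [- w] is at most
    [- r] for each [(w, r)] in [W]. A linear functional below it then satisfies
    [r <= L w], so that lower bounds on [L] become one more domination. *)
Definition lower_by W p u := inf [set p (u + z.1) - z.2 | z in W].

Section lower_by.
Context {p W}.
Hypotheses (sp : sublinear p) (cW : convex_cone W).
Hypothesis Wp : forall z, W z -> z.2 <= p z.1.

Let lower_by_set u := [set p (u + z.1) - z.2 | z in W].

Let lbnd u : has_lbound (lower_by_set u).
Proof.
exists (- p (- u)) => _ [z Wz <-].
have [pD _] := sp; have := pD (u + z.1) (- u); rewrite addrC addKr.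
by have := Wp z Wz; lra.
Qed.

Let nonempty u : lower_by_set u !=set0.
Proof. by have [W0 _ _] := cW; exists (p (u + 0) - 0), (0, 0). Qed.

Lemma lower_by_le u z : W z -> lower_by W p u <= p (u + z.1) - z.2.
Proof. by move=> Wz; apply: ge_inf; [exact: lbnd | exists z]. Qed.

Lemma lower_by_le_id u : lower_by W p u <= p u.
Proof.
by have [W0 _ _] := cW; have := lower_by_le u _ W0; rewrite addr0 subr0.
Qed.

Lemma sublinear_lower_by : sublinear (lower_by W p).
Proof.
have [_ WD WZ] := cW; have [pD _] := sp.
split=> [u v|t u t0].
- rewrite -lerBlDr; apply: (lb_le_inf (nonempty _)) => _ [z Wz <-].
  rewrite lerBlDr -lerBlDl; apply: (lb_le_inf (nonempty _)) => _ [z' Wz' <-].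
  rewrite lerBlDl.
  apply: le_trans (lower_by_le _ _ (WD _ _ Wz Wz')) _ => /=.
  by have := pD (u + z.1) (v + z'.1); rewrite addrACA; lra.
- rewrite -ler_pdivrMl//; apply: (lb_le_inf (nonempty _)) => _ [z Wz <-].
  rewrite ler_pdivrMl//.
  apply: le_trans (lower_by_le _ _ (WZ _ _ t0 Wz)) _ => /=.
  by rewrite -scalerDr sublinearZ// mulrBr.
Qed.

End lower_by.

(** Zorn's lemma applies because the pointwise infimum of a chain is again
    sublinear. It is finite since [- p (- u)] is a lower bound at [u] for all
    sublinear functionals below [p]. *)
Lemma minimal_sublinear p : sublinear p ->
  exists q, [/\ sublinear q, forall u, q u <= p u &
    forall q', sublinear q' -> (forall u, q' u <= q u) ->
      forall u, q u <= q' u].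
Proof.
move=> sp.
pose S := {q | sublinear q /\ forall u, q u <= p u}.
pose below (q q' : S) := `[< forall u, sval q' u <= sval q u >].
have belowP (q q' : S) : reflect (forall u, sval q' u <= sval q u) (below q q').
  exact: asboolP.
have pS : sublinear p /\ forall u, p u <= p u by [].
have [||A tA|[q [sq qp]] qmin] := @ZL_preorder S (exist _ p pS) below.
- by move=> q; apply/belowP.
- move=> r s t /belowP rs /belowP st; apply/belowP => u.
  exact: le_trans (st u) (rs u).
- have [[q0 Aq0]|A0] := pselect (A !=set0); last first.
    by exists (exist _ p pS) => s As; exfalso; apply: A0; exists s.
  pose Au u := [set sval q u | q in A].
  pose m u := inf (Au u).
  have lbnd u : has_lbound (Au u).
    exists (- p (- u)) => _ [[q [sq qp]] /= Aq <-].
    by have := sublinearN _ u sq; have := qp (- u); lra.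
  have nonempty u : Au u !=set0 by exists (sval q0 u), q0.
  have m_le (s : S) u : A s -> m u <= sval s u.
    by move=> As; apply: ge_inf; [exact: lbnd | exists s].
  have sm : sublinear m.
    split=> [u v|t u t0].
    + rewrite -lerBlDr; apply: (lb_le_inf (nonempty _)) => _ [q Aq <-].
      rewrite lerBlDr -lerBlDl.
      apply: (lb_le_inf (nonempty _)) => _ [q' Aq' <-].
      rewrite lerBlDl.
      have [/belowP le|/belowP le] := tA q q' Aq Aq'.
      * have [[qD _] _] := svalP q'; apply: le_trans (m_le _ _ Aq') _.
        by apply: le_trans (qD _ _) _; rewrite lerD2r.
      * have [[qD _] _] := svalP q; apply: le_trans (m_le _ _ Aq) _.
        by apply: le_trans (qD _ _) _; rewrite lerD2l.
    + rewrite -ler_pdivrMl//; apply: (lb_le_inf (nonempty _)) => _ [q Aq <-].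
      rewrite ler_pdivrMl//; have [[_ qZ] _] := svalP q.
      exact: le_trans (m_le _ _ Aq) (qZ _ _ t0).
  have mp u : m u <= p u.
    by apply: le_trans (m_le q0 u Aq0) _; have [_] := svalP q0; exact.
  exists (exist _ m (conj sm mp)) => q Aq.
  by apply/belowP => u; exact: m_le.
- exists q; split => // q' sq' q'q u.
  have q'p v : q' v <= p v by exact: le_trans (q'q v) (qp v).
  have /belowP := qmin (exist _ q' (conj sq' q'p)) ltac:(by apply/belowP).
  exact.
Qed.

(** Lowering [q] along the ray generated by [(v, q v)] must leave it unchanged,
    by minimality; this is the missing inequality [q u + q v <= q (u + v)]. *)
Lemma minimal_sublinear_linear q : sublinear q ->
  (forall q', sublinear q' -> (forall u, q' u <= q u) ->
    forall u, q u <= q' u) ->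
  linear (q : V -> R^o).
Proof.
move=> sq qmin; have [qD _] := sq.
have addq u v : q (u + v) = q u + q v.
  apply/eqP; rewrite eq_le qD/=.
  pose W : set (V * R) := [set z | exists2 t, 0 <= t & z = (t *: v, t * q v)].
  have cW : convex_cone W.
    split=> [|_ _ [t t0 ->] [t' t'0 ->]|s _ s0 [t t0 ->]] /=.
    - by exists 0; rewrite ?scale0r ?mul0r.
    - by exists (t + t'); [exact: addr_ge0 | rewrite scalerDl mulrDl].
    - by exists (s * t); [exact: mulr_ge0 (ltW _) _ | rewrite scalerA mulrA].
  have Wq z : W z -> z.2 <= q z.1.
    case=> t; rewrite le_eqVlt => /predU1P[<-|t0] -> /=.
      by rewrite scale0r mul0r sublinear0.
    by rewrite sublinearZ.
  have le := qmin _ (sublinear_lower_by sq cW Wq) (lower_by_le_id sq cW Wq) u.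
  have Wv : W (v, q v) by exists 1; rewrite ?scale1r ?mul1r.
  by have := lower_by_le sq Wq u _ Wv; rewrite /=; lra.
have qN u : q (- u) = - q u.
  by have := addq u (- u); rewrite subrr sublinear0//; lra.
move=> t u v; rewrite addq; congr (_ + _).
have [t0|t0|->] := ltgtP t 0.
- rewrite -[in LHS](opprK t) scaleNr qN sublinearZ ?oppr_gt0//.
  by rewrite mulNr opprK.
- by rewrite sublinearZ.
- by rewrite scale0r sublinear0// scale0r.
Qed.

(** A form of the Hahn-Banach theorem in which [L] is bounded from above by [p]
    and from below on a cone. *)
Theorem mazur_orlicz p W : sublinear p -> convex_cone W ->
  (forall z, W z -> z.2 <= p z.1) ->
  exists2 L : {linear V -> R^o}, forall u, L u <= p u &
    forall z, W z -> z.2 <= L z.1.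
Proof.
move=> sp cW Wp.
have [L [sL Lle Lmin]] := minimal_sublinear _ (sublinear_lower_by sp cW Wp).
have linL := minimal_sublinear_linear _ sL Lmin.
pose linL' := GRing.isLinear.Build R V R^o *:%R L linL.
pose LL : {linear V -> R^o} := HB.pack L linL'.
exists LL => /= [u|z Wz].
  exact: le_trans (Lle u) (lower_by_le_id sp cW Wp u).
have := le_trans (Lle (- z.1)) (lower_by_le sp Wp (- z.1) _ Wz).
rewrite addNr sublinear0//.
by have := sublinearN _ z.1 sL; lra.
Qed.

End MazurOrlicz.

(** * Means on bounded functions and finitely additive probabilities *)

Section BoundedFunctions.
Context {T : Type} {R : realType}.

Definition bounded_on_all : {pred T -> R^o} :=
  fun f => `[< exists M, forall t, `|f t| <= M >].

Lemma bounded_on_all_submod_closed : submod_closed bounded_on_all.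
Proof.
split=> [|a u v /asboolP[M uM] /asboolP[N vN]]; apply/asboolP.
  by exists 0 => t; rewrite normr0.
exists (`|a| * M + N) => t; apply: le_trans (ler_normD _ _) _.
by rewrite lerD// normrM ler_wpM2l.
Qed.

HB.instance Definition _ := GRing.isSubmodClosed.Build _ _ bounded_on_all
  bounded_on_all_submod_closed.

Record bfun := BFun { bfun_val :> T -> R^o ; _ : bfun_val \in bounded_on_all }.

HB.instance Definition _ := [isSub for bfun_val].
HB.instance Definition _ := [Choice of bfun by <:].
HB.instance Definition _ := [SubChoice_isSubLmodule of bfun by <:].

Lemma bfunP (u : bfun) : exists M, forall t, `|u t| <= M.
Proof. by apply/asboolP; exact: (valP u). Qed.

Lemma bfunD (u v : bfun) t : (u + v) t = u t + v t.
Proof. by []. Qed.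

Lemma bfunZ a (u : bfun) t : (a *: u) t = a * u t.
Proof. by []. Qed.

Lemma bfun_sum (J : Type) (s : seq J) (u : J -> bfun) t :
  (\sum_(j <- s) u j) t = \sum_(j <- s) u j t.
Proof. by elim/big_ind2 : _ => // _ x _ y <- <-. Qed.

Definition bfun_of (f : T -> R) (M : R) (fM : forall t, 0 <= f t <= M) : bfun.
Proof.
exists f; apply/asboolP; exists M => t.
by have /andP[f0 ?] := fM t; rewrite ger0_norm.
Defined.

Lemma indic_unit (A : set T) (t : T) : (0 : R) <= (\1_A t : R) <= (1 : R).
Proof. by rewrite indicE ler0n lern1 leq_b1. Qed.

Definition bindic (A : set T) : bfun := bfun_of _ _ (indic_unit A).

End BoundedFunctions.
Arguments bfun : clear implicits.

Section Mean.
Context {T : pointedType} {R : realType}.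
Implicit Types u v : bfun T R.

Definition bfun_sup u : R := sup (range u).

Lemma le_bfun_sup u t : u t <= bfun_sup u.
Proof.
apply: ub_le_sup; last by exists t.
have [M uM] := bfunP u; exists M => _ [s _ <-].
exact: le_trans (ler_norm _) _.
Qed.

Lemma bfun_sup_le u x : (forall t, u t <= x) -> bfun_sup u <= x.
Proof.
by move=> ux; apply: ge_sup => [|_ [t _ <-]//]; exists (u point), point.
Qed.

Lemma sublinear_bfun_sup : sublinear bfun_sup.
Proof.
split=> [u v|a u a0]; apply: bfun_sup_le => t.
  by rewrite bfunD lerD// le_bfun_sup.
by rewrite bfunZ ler_pM2l// le_bfun_sup.
Qed.

Lemma mean_mono (L : {linear bfun T R -> R^o}) u v :
  (forall w, L w <= bfun_sup w) -> (forall t, u t <= v t) -> L u <= L v.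
Proof.
move=> Lsup uv; rewrite -subr_le0 -linearB.
apply: le_trans (Lsup _) (bfun_sup_le _ _ _) => t.
by rewrite -[_ t]/(u t - v t) subr_le0.
Qed.

End Mean.

(** Nonnegative real weights are, up to a factor [n], multiplicities in a
    sequence, with an error that does not grow with [n]. The multiplicity of an
    index of weight [w] is the integer part of [n * w], and the same sequence
    serves for every [h]. *)
Lemma repeat_approx {R : realType} {I : Type} (n : nat) (s : seq (R * I)) :
  all (fun z => 0 <= z.1) s ->
  exists s' : seq I, forall h : I -> R, (forall i, 0 <= h i) ->
    \sum_(i <- s') h i <= n%:R * \sum_(z <- s) z.1 * h z.2 /\
    n%:R * \sum_(z <- s) z.1 * h z.2 <=
      \sum_(i <- s') h i + \sum_(z <- s) h z.2.
Proof.
elim: s => [_|z s IH /= /andP[z0 /IH[s' s'h]]].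
  by exists [::] => h _; rewrite !big_nil mulr0 addr0.
exists (nseq (Num.truncn (n%:R * z.1)) z.2 ++ s') => h h0.
have [le1 le2] := s'h h h0.
have nz0 : 0 <= n%:R * z.1 by rewrite mulr_ge0.
have /andP[tr1 tr2] := truncn_itv nz0.
rewrite big_cat !big_cons/= big_nseq iter_addr_0 -[h z.2 *+ _]mulr_natl.
rewrite mulrDr mulrA.
have := ler_wpM2r (h0 z.2) (ltW tr2); have := ler_wpM2r (h0 z.2) tr1.
rewrite -natr1 mulrDl mul1r.
by move=> h1 h2; split; lra.
Qed.

(** The sum is the integer part of [y], except at [y = M.+1] where it is [M].
    Applied to the values of a function, it compares the function with a sum of
    indicators of level sets. *)
Lemma staircase {R : realType} (y : R) (M : nat) : 0 <= y <= M.+1%:R ->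
  y - 1 <= \sum_(j < M) (j.+1%:R <= y)%R%:R <= y.
Proof.
move=> /andP[y0]; elim: M => [|M IH] yM.
  by rewrite big_ord0 y0 andbT; lra.
rewrite big_ord_recr/=; have [My|yltM] := leP M.+1%:R y; last first.
  by rewrite addr0 IH// ltW.
rewrite (eq_bigr (fun=> 1)) => [|j _].
  rewrite sumr_const card_ord -natrD addn1 My andbT.
  by move: yM; rewrite -(natr1 M.+1); lra.
by rewrite (le_trans _ My)// ler_nat ltnS ltnW.
Qed.

Section Content.
Context {T : pointedType} {R : realType}.

Definition finitely_additive_prob (nu : set T -> R) :=
  [/\ forall A, 0 <= nu A, nu setT = 1 &
      forall A B, A `&` B = set0 -> nu (A `|` B) = nu A + nu B].

Context {I : Type} (g : I -> T -> R) (c : I -> R).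
Hypothesis g0 : forall i t, 0 <= g i t.
Hypothesis bg : forall i, exists M, forall t, g i t <= M.
Hypothesis c0 : forall i, 0 <= c i.
Hypothesis le_sup : forall s : seq I,
  \sum_(i <- s) c i <= sup (range (fun t => \sum_(i <- s) g i t)).

Let G : forall i, {u : bfun T R | forall t, u t = g i t}.
Proof.
move=> i; have [M gM] := cid (bg i).
have giM t : 0 <= g i t <= M by rewrite g0 gM.
by exists (bfun_of _ _ giM).
Qed.

(** The approximation error [\sum_(z <- s) c z.2] is divided by [n], which is
    taken large. *)
Let le_sup_weighted (s : seq (R * I)) : all (fun z => 0 <= z.1) s ->
  \sum_(z <- s) z.1 * c z.2 <= bfun_sup (\sum_(z <- s) z.1 *: sval (G z.2)).
Proof.
move=> s0; set A := leLHS; set B := bfun_sup _.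
have D0 : 0 <= \sum_(z <- s) c z.2 by apply: sumr_ge0.
apply/ler_addgt0Pr => e e0.
pose n := (Num.truncn ((\sum_(z <- s) c z.2) / e)).+1.
have n0 : 0 < n%:R :> R by rewrite ltr0n.
have De : \sum_(z <- s) c z.2 <= n%:R * e.
  rewrite -ler_pdivrMr//; apply: ltW.
  by have /andP[_] := truncn_itv (divr_ge0 D0 (ltW e0)).
have [s' s'h] := repeat_approx n s s0.
have [_ le1] := s'h c c0.
have le2 : sup (range (fun t => \sum_(i <- s') g i t)) <= n%:R * B.
  apply: ge_sup; first by exists (\sum_(i <- s') g i point), point.
  move=> _ [t _ <-]; have [le2 _] := s'h (g ^~ t) (g0 ^~ t).
  apply: le_trans le2 _; rewrite ler_pM2l//.
  apply: le_trans (le_bfun_sup _ t); rewrite bfun_sum.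
  by apply: ler_sum => z _; rewrite bfunZ (svalP (G z.2)).
rewrite -(ler_pM2l n0) mulrDr; rewrite -/A in le1.
by have := le_sup s'; lra.
Qed.

(** The pairs of a combination of the [g i] and the same combination of the
    [c i], with nonnegative weights, form a cone to which the Mazur-Orlicz
    theorem applies. *)
Lemma dominating_mean : exists2 L : {linear bfun T R -> R^o},
  forall u, L u <= bfun_sup u &
  forall i (u : bfun T R), (forall t, g i t <= u t) -> c i <= L u.
Proof.
pose W : set (bfun T R * R) := [set z | exists2 s : seq (R * I),
  all (fun z => 0 <= z.1) s &
  z = (\sum_(z <- s) z.1 *: sval (G z.2), \sum_(z <- s) z.1 * c z.2)].
have cW : convex_cone W.
  split=> [|_ _ [s s0 ->] [s' s'0 ->]|a _ a0 [s s0 ->]] /=.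
  - by exists [::] => //; rewrite !big_nil.
  - by exists (s ++ s'); rewrite ?all_cat ?s0// !big_cat.
  - exists [seq (a * z.1, z.2) | z <- s].
      rewrite all_map; apply: sub_all s0 => z /= z0.
      by rewrite mulr_ge0// ltW.
    rewrite !big_map scaler_sumr mulr_sumr.
    by congr (_, _); apply: eq_bigr => z _; rewrite ?scalerA ?mulrA.
have Wp z : W z -> z.2 <= bfun_sup z.1.
  by move=> [s s0 ->]; exact: le_sup_weighted.
have [L Lsup LW] := mazur_orlicz _ _ sublinear_bfun_sup cW Wp.
exists L => // i u giu.
have Wi : W (sval (G i), c i).
  by exists [:: (1, i)]; rewrite /= ?ler01// !big_seq1 scale1r mul1r.
apply: le_trans (LW _ Wi) _; apply: mean_mono => // t.
by rewrite /= (svalP (G i)).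
Qed.

(** The mean of [g i] is recovered from the measure of its level sets up to
    [n^-1], which makes it possible to replace the functional by the set
    function that it induces. *)
Theorem dominating_content : exists2 nu : set T -> R,
  finitely_additive_prob nu &
  forall i (n M : nat), (0 < n)%N -> (forall t, n%:R * g i t <= M.+1%:R) ->
    n%:R * c i <= 1 + \sum_(j < M) nu [set t | j.+1%:R <= n%:R * g i t].
Proof.
have [L Lsup Lg] := dominating_mean.
have mono := mean_mono L _ _ Lsup.
have L1 : L (bindic setT) = 1.
  apply/eqP; rewrite eq_le; apply/andP; split.
    apply: le_trans (Lsup _) _; apply: bfun_sup_le => t.
    by have /andP[] := @indic_unit T R setT t.
  rewrite -lerN2 -linearN; apply: le_trans (Lsup _) _; apply: bfun_sup_le => t.
  by rewrite -[_ t]/(- \1_setT t) indicT lerN2.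
exists (fun A => L (bindic A)).
  split=> [A||A B AB0].
  - rewrite -[leLHS](linear0 L); apply: mono => t.
    by have /andP[] := @indic_unit T R A t.
  - exact: L1.
  - rewrite -linearD; congr (L _); apply/val_inj/funext => t.
    rewrite -[RHS]/(\1_A t + \1_B t) -[LHS]/(\1_(A `|` B) t) !indicE in_setU.
    case: (boolP (t \in A)) => [/set_mem At|_]; last by rewrite add0r.
    by rewrite memNset ?addr0// => Bt; have : (A `&` B) t by []; rewrite AB0.
move=> i n M n0 gM.
have nR0 : 0 < n%:R :> R by rewrite ltr0n.
pose S j := [set t | j.+1%:R <= n%:R * g i t].
pose u := bindic setT + \sum_(j < M) bindic (S j) : bfun T R.
have giu t : n%:R * g i t <= u t.
  have y : 0 <= n%:R * g i t <= M.+1%:R by rewrite gM mulr_ge0.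
  have -> : u t = 1 + \sum_(j < M) \1_(S j) t.
    rewrite /u bfunD bfun_sum; congr (_ + _).
    by rewrite -[LHS]/(\1_setT t) indicT.
  have /andP[+ _] := staircase _ _ y; rewrite lerBlDl => /le_trans; apply.
  rewrite lerD2l; apply: ler_sum => j _; rewrite indicE.
  case: (boolP (j.+1%:R <= n%:R * g i t)) => [jg|_]; last exact: ler0n.
  by rewrite mem_set.
rewrite -ler_pdivlMl//.
have -> : n%:R^-1 * (1 + \sum_(j < M) L (bindic (S j))) = L (n%:R^-1 *: u) :> R.
  by rewrite linearZ linearD linear_sum L1.
by apply: Lg => t; rewrite bfunZ ler_pdivlMl.
Qed.

End Content.

(** * From a content to a regular Borel probability *)

Section ContentMeasure.
Context {R : realType} {T : ptopologicalType} {nu : set T -> R}.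
Hypotheses (hausT : hausdorff_space T) (compT : compact [set: T]).
Hypothesis nuP : finitely_additive_prob nu.
Implicit Types (A B C U V : set T).

Local Notation borel := (g_sigma_algebraType (@open T)).

Let nu_ge0 A : 0 <= nu A. Proof. by case: nuP. Qed.

Let nuT : nu setT = 1. Proof. by case: nuP. Qed.

Let nuU A B : A `&` B = set0 -> nu (A `|` B) = nu A + nu B.
Proof. by case: nuP => _ _; exact. Qed.

Let nu0 : nu set0 = 0.
Proof. by have := nuU set0 set0 (setI0 _); rewrite setU0; lra. Qed.

Let nuDl A B : A `<=` B -> nu B = nu A + nu (B `\` A).
Proof. by move=> AB; rewrite -nuU ?setDIK// setDUK. Qed.

Let nu_mono A B : A `<=` B -> nu A <= nu B.
Proof. by move=> AB; rewrite (nuDl _ _ AB) lerDl. Qed.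

Let nu_subadd A B : nu (A `|` B) <= nu A + nu B.
Proof.
rewrite (nuDl A (A `|` B)) ?lerD2l; last exact: subsetUl.
by apply: nu_mono => t [[//|]].
Qed.

Definition inner_content U :=
  sup [set nu C | C in [set C | closed C /\ C `<=` U]].
Local Notation rho := inner_content.

Let le_rho C U : closed C -> C `<=` U -> nu C <= rho U.
Proof.
move=> cC CU; apply: ub_le_sup; last by exists C.
by exists 1 => _ [D _ <-]; rewrite -nuT; exact: nu_mono.
Qed.

Let rho_le U x : (forall C, closed C -> C `<=` U -> nu C <= x) -> rho U <= x.
Proof.
move=> Ux; apply: ge_sup => [|_ [C [cC CU] <-]]; last exact: Ux.
by exists (nu set0), set0 => //; split; [exact: closed0 | exact: sub0set].
Qed.

Let rho_mono U V : U `<=` V -> rho U <= rho V.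
Proof.
move=> UV; apply: rho_le => C cC CU; apply: le_rho => //.
exact: subset_trans UV.
Qed.

Let rho_ge0 U : 0 <= rho U.
Proof. by rewrite -nu0; apply: le_rho; [exact: closed0 | exact: sub0set]. Qed.

Let rho_le1 U : rho U <= 1.
Proof. by apply: rho_le => C _ _; rewrite -nuT; exact: nu_mono. Qed.

(** Normality of [T] separates [C `\` U] from [C `\` V] by open sets, which are
    then removed from [C]. *)
Let closed_split C U V : closed C -> open U -> open V -> C `<=` U `|` V ->
  exists C1 C2, [/\ closed C1, closed C2, C1 `<=` U, C2 `<=` V & C = C1 `|` C2].
Proof.
move=> cC oU oV CUV.
have cD W : open W -> closed (C `\` W).
  by move=> oW; rewrite setDE; apply: closedI; rewrite ?closedC.
have dis : (C `\` U) `&` (C `\` V) = set0.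
  by apply/seteqP; split=> // t [[Ct nUt] [_ nVt]]; have [] := CUV t Ct.
have [U' [V' [oU' oV' CU' CV' UV'0]]] :=
  (iffLR (@normal_openP R T) (compact_normal hausT compT)) _ _
    (cD _ oU) (cD _ oV) dis.
exists (C `\` U'), (C `\` V'); split; [exact: cD|exact: cD| | |].
- by move=> t [Ct nU't]; apply: contrapT => nUt; exact/nU't/CU'.
- by move=> t [Ct nV't]; apply: contrapT => nVt; exact/nV't/CV'.
- apply/seteqP; split=> [t Ct|t [[]|[]]//].
  have [U't|] := pselect (U' t); last by left.
  right; split=> // V't; have : (U' `&` V') t by [].
  by rewrite UV'0.
Qed.

Let nu_le_sum_rho (U : nat -> set T) n C : (forall i, open (U i)) -> closed C ->
  C `<=` \bigcup_(i < n) U i -> nu C <= \sum_(i < n) rho (U i).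
Proof.
move=> oU; elim: n C => [|n IH] C cC.
  by rewrite bigcup_mkord big_ord0 subset0 big_ord0 => ->; rewrite nu0.
rewrite bigcup_mkord big_ord_recr -bigcup_mkord big_ord_recr/= => CU.
have oUn : open (\bigcup_(i < n) U i) by apply: bigcup_open.
have [C1 [C2 [cC1 cC2 C1U C2U ->]]] := closed_split _ _ _ cC oUn (oU n) CU.
apply: le_trans (nu_subadd _ _) _; apply: lerD; first exact: IH.
exact: le_rho.
Qed.

(** By compactness, a closed subset of the union lies in a finite subunion. *)
Let rho_sigma_subadd (U : nat -> set T) : (forall i, open (U i)) ->
  ((rho (\bigcup_i U i))%:E <= \sum_(i <oo) (rho (U i))%:E)%E.
Proof.
move=> oU.
have sum_ge n : ((\sum_(i < n) rho (U i))%:E <= \sum_(i <oo) (rho (U i))%:E)%E.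
  rewrite -sumEFin -(big_mkord xpredT (fun i => (rho (U i))%:E)).
  by apply: nneseries_lim_ge => i _ _; rewrite lee_fin.
suff le x : (\sum_(i <oo) (rho (U i))%:E <= x%:E)%E -> rho (\bigcup_i U i) <= x.
  case Ex : (\sum_(i <oo) (rho (U i))%:E)%E => [x| |]; rewrite ?leey//.
    by rewrite lee_fin; apply: le; rewrite Ex.
  by have := sum_ge 0%N; rewrite Ex.
move=> sumx; apply: rho_le => C cC CU.
have := subclosed_compact cC compT (@subsetT _ C).
rewrite compact_cover => /(_ nat setT U) [||D _ CD]; [by []|by []|].
pose n := (\max_(i <- enum_fset D) i).+1.
rewrite -lee_fin; apply: le_trans (le_trans (sum_ge n) sumx).
rewrite lee_fin; apply: nu_le_sum_rho => // t /CD[i /= iD Uit].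
by exists i => //=; rewrite ltnS; exact: leq_bigmax_seq.
Qed.

Definition content_outer A : \bar R :=
  ereal_inf [set (rho U)%:E | U in [set U | open U /\ A `<=` U]].
Local Notation mu := content_outer.

Let mu_le A U : open U -> A `<=` U -> (mu A <= (rho U)%:E)%E.
Proof. by move=> oU AU; apply: ereal_inf_lbound; exists U. Qed.

Let mu_ge A x :
  (forall U, open U -> A `<=` U -> (x <= (rho U)%:E)%E) -> (x <= mu A)%E.
Proof.
by move=> Ax; apply: le_ereal_inf_tmp => _ [U [oU AU] <-]; exact: Ax.
Qed.

Let mu_open U : open U -> mu U = (rho U)%:E.
Proof.
move=> oU; apply/eqP; rewrite eq_le mu_le//=; apply: mu_ge => V oV UV.
by rewrite lee_fin rho_mono.
Qed.

Let mu_ge0 A : (0 <= mu A)%E.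
Proof. by apply: mu_ge => U _ _; rewrite lee_fin. Qed.

Let mu_fin A : mu A \is a fin_num.
Proof.
rewrite ge0_fin_numE//.
apply: le_lt_trans (mu_le A setT openT (@subsetT _ _)) _.
exact: ltry.
Qed.

Let mu0 : mu set0 = 0%E.
Proof.
rewrite mu_open; last exact: open0.
congr (_%:E); apply/eqP; rewrite eq_le rho_ge0 andbT; apply: rho_le => C _.
by rewrite subset0 => ->; rewrite nu0.
Qed.

Let mu_mono : {homo mu : A B / A `<=` B >-> (A <= B)%E}.
Proof.
move=> A B AB; apply: mu_ge => U oU BU; apply: mu_le => //.
exact: subset_trans BU.
Qed.

Let mu_sigma_subadd : sigma_subadditive mu.
Proof.
move=> F; apply/lee_addgt0Pr => e e0.
have /choice[U UP] n : exists U, [/\ open U, F n `<=` U &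
    ((rho U)%:E <= mu (F n) + (e / (2 ^ n.+1)%:R)%:E)%E].
  have e'0 : 0 < e / (2 ^ n.+1)%:R by rewrite divr_gt0// ltr0n expn_gt0.
  have [_ [U [oU FU] <-] lt] := lb_ereal_inf_adherent e'0 (mu_fin (F n)).
  by exists U; split=> //; exact: ltW.
apply: le_trans (epsilon_trick xpredT (fun n => mu_ge0 (F n)) (ltW e0)).
apply: (@le_trans _ _ (\sum_(n <oo) (rho (U n))%:E)%E).
  apply: le_trans (rho_sigma_subadd _ _); last by move=> n; have [] := UP n.
  apply: mu_le; first by apply: bigcup_open => n _; have [] := UP n.
  by apply: subset_bigcup => n _; have [] := UP n.
apply: lee_nneseries => n _; first by rewrite lee_fin.
by have [_ _] := UP n.
Qed.

Let outer_mixin :=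
  isOuterMeasure.Build R T mu mu0 mu_ge0 mu_mono mu_sigma_subadd.
Let outer : {outer_measure set T -> \bar R} := HB.pack mu outer_mixin.

(** For [V] open, choose a closed [C] in [V `&` U] that almost exhausts it, then
    a closed [D] in the open set [V `\` C], which contains [V `\` U]. As [C]
    and [D] are disjoint, [nu C + nu D = nu (C `|` D) <= rho V]. *)
Let open_caratheodory U : open U -> outer.-caratheodory U.
Proof.
move=> oU; apply: le_caratheodory_measurable => X /=.
apply: mu_ge => V oV XV.
rewrite -[(_ <= _)%E]leeBrDr ?mu_fin//.
have muXU : (mu (X `&` U) <= (rho (V `&` U))%:E)%E.
  by apply: mu_le; [exact: openI | exact: setSI].
apply: le_trans muXU _.
rewrite -(fineK (mu_fin (X `&` ~` U))) -EFinB lee_fin.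
apply: rho_le => C cC CVU; rewrite lerBrDr -lerBrDl -lee_fin fineK ?mu_fin//.
have oVC : open (V `\` C) by rewrite setDE; apply: openI; rewrite ?openC.
apply: le_trans (mu_le _ (V `\` C) oVC _) _.
  by move=> t [Xt nUt]; split; [exact: XV | move=> /CVU[]].
rewrite lee_fin; apply: rho_le => D cD DVC; rewrite lerBrDl.
rewrite -nuU; last by apply/seteqP; split=> // t [Ct /DVC[]].
apply: le_rho; first exact: closedU.
by move=> t [/CVU[]|/DVC[]].
Qed.

Let borel_caratheodory (A : set borel) : measurable A -> outer.-caratheodory A.
Proof.
apply: smallest_sub => [|U oU]; last exact: open_caratheodory.
split=> [|B cB|F cF].
- exact: caratheodory_measurable_set0.
- by rewrite setTD; exact: caratheodory_measurable_setC.
- exact: caratheodory_measurable_bigcup.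
Qed.

Let mu_sigma_additive : semi_sigma_additive (mu : set borel -> \bar R).
Proof.
move=> F mF tF mUF.
have := @caratheodory_measure_sigma_additive R T outer F.
apply=> // [n|]; exact: borel_caratheodory.
Qed.

Let measure_mixin := isMeasure.Build _ borel R mu mu0 mu_ge0 mu_sigma_additive.
Let content_measure : {measure set borel -> \bar R} := HB.pack mu measure_mixin.

Let content_measureT : content_measure setT = 1%E.
Proof.
rewrite /= mu_open; last exact: openT.
congr (_%:E); apply/eqP; rewrite eq_le rho_le1 -nuT; exact: le_rho.
Qed.

Let probability_mixin :=
  Measure_isProbability.Build _ _ _ content_measure content_measureT.
Let content_probability : probability borel R :=
  HB.pack mu measure_mixin probability_mixin.

Let nu_le_mu C : closed C -> ((nu C)%:E <= mu C)%E.
Proof.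
by move=> cC; apply: mu_ge => U _ CU; rewrite lee_fin; exact: le_rho.
Qed.

(** The measure exceeds [nu] on closed sets because every open set around a
    closed set [C] competes with [C] in the definition of [inner_content]. Outer
    regularity is built in; inner regularity follows by taking complements,
    since closed sets are compact. *)
Theorem content_regular_probability : exists mu : probability borel R,
  [/\ forall A : set borel, measurable A ->
        mu A = ereal_inf [set mu U | U in [set U : set T | open U /\ A `<=` U]],
      forall A : set borel, measurable A ->
        mu A =
          ereal_sup [set mu Q | Q in [set Q : set T | compact Q /\ Q `<=` A]] &
      forall C : set T, closed C -> ((nu C)%:E <= mu C)%E].
Proof.
exists content_probability; split=> [A _|A mA|]; last exact: nu_le_mu.
- congr (ereal_inf _); apply/seteqP; split=> _ [U [oU AU] <-];
    by exists U => //=; rewrite mu_open.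
- apply/eqP; rewrite eq_le; apply/andP; split; last first.
    by apply: ge_ereal_sup => _ [Q [_ QA] <-]; exact: mu_mono.
  apply/lee_addgt0Pr => e e0.
  have [_ [U [oU AU] <-] lt] := lb_ereal_inf_adherent e0 (mu_fin (~` A)).
  have mU : measurable (U : set borel) by exact: sub_sigma_algebra.
  have cQ : compact (~` U).
    by apply: subclosed_compact compT _ => //; exact: open_closedC.
  have QA : ~` U `<=` A by rewrite -[A]setCK; exact: subsetC.
  apply: (@le_trans _ _ (content_probability (~` U) + e%:E)%E); last first.
    by rewrite leeD2r//; apply: ereal_sup_ubound; exists (~` U).
  have muC B : measurable (B : set borel) -> mu (~` B) = (1 - mu B)%E.
    exact: (probability_setC content_probability).
  rewrite -[leLHS]/(mu A) -[X in (X + _)%E]/(mu (~` U)) muC//.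
  move: lt; rewrite -mu_open// -/(mu (~` A)) muC//.
  rewrite -(fineK (mu_fin A)) -(fineK (mu_fin U)) -!EFinB -!EFinD.
  rewrite lte_fin lee_fin.
  lra.
Qed.

End ContentMeasure.

Section Integration.
Context {R : realType} {T : ptopologicalType}.
Local Notation borel := (g_sigma_algebraType (@open T)).

Lemma continuous_borel_measurable (g : T -> R) : continuous g ->
  measurable_fun setT (g : borel -> R).
Proof.
move=> cg.
apply: (measurability _ (RGenOpens.measurableE R)) => _ [_ [a [b ->]] <-].
rewrite setTI; apply: sub_sigma_algebra.
by apply: (iffLR (continuousP _)) => //; exact: interval_open.
Qed.

Lemma closed_level_set (g : T -> R) (a b : R) : continuous g ->
  closed [set t | a <= b * g t].
Proof.
move=> cg; have cbg : continuous (fun t => b * g t).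
  by move=> t; apply: cvgM; [exact: cvg_cst | exact: cg].
exact: (iffLR (continuous_closedP _) cbg _ (@closed_ge _ a)).
Qed.

Lemma closed_borel_measurable (C : set T) :
  closed C -> measurable (C : set borel).
Proof.
move=> cC; rewrite -[C]setCK; apply: measurableC; apply: sub_sigma_algebra.
by rewrite /= openC.
Qed.

(** By [staircase], [n * g] exceeds the sum of the indicators of its level sets
    at the positive integers, so that [n * c <= 1 + n * \int g] for every
    [n]. *)
Lemma le_integral_of_level_sets (mu : probability borel R) (g : T -> R)
    (c M : R) :
  continuous g -> (forall t, 0 <= g t <= M) ->
  (forall n N : nat, (0 < n)%N -> (forall t, n%:R * g t <= N.+1%:R) ->
    ((n%:R * c)%:E <=
     1 + \sum_(j < N) mu [set t | (j.+1%:R <= n%:R * g t)%R])%E) ->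
  (c%:E <= \int[mu]_t (g t)%:E)%E.
Proof.
move=> cg gM levels; apply/lee_addgt0Pr => e e0.
have g0 t : 0 <= g t by have /andP[] := gM t.
pose n := (Num.truncn e^-1).+1.
pose N := Num.truncn (n%:R * M).
have n0 : 0 < n%:R :> R by rewrite ltr0n.
have ne : 1 <= n%:R * e.
  rewrite -ler_pdivrMr// div1r ltW//.
  have e'0 : 0 <= e^-1 by rewrite invr_ge0 ltW.
  by have /andP[] := truncn_itv e'0.
have gN t : n%:R * g t <= N.+1%:R.
  have /andP[_ gtM] := gM t.
  have M0 : 0 <= n%:R * M by rewrite mulr_ge0// (le_trans (g0 t)).
  have /andP[_ /ltW] := truncn_itv M0; apply: le_trans.
  by rewrite ler_pM2l.
have mg : measurable_fun setT (g : borel -> R).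
  exact: continuous_borel_measurable.
pose S j : set borel := [set t | j.+1%:R <= n%:R * g t].
have mS j : measurable (S j).
  by apply: closed_borel_measurable; exact: closed_level_set.
have : ((n%:R * c)%:E <= 1 + n%:R%:E * \int[mu]_t (g t)%:E)%E.
  apply: le_trans (levels n N isT gN) _; rewrite leeD2l//.
  rewrite -ge0_integralZl_EFin//; last 2 first.
  - by move=> t _; rewrite lee_fin.
  - exact/measurable_EFinP.
  have -> : (\sum_(j < N) mu (S j) =
             \int[mu]_t \sum_(j < N) (\1_(S j) t)%:E)%E.
    rewrite ge0_integral_sum//; last first.
      by move=> j; apply/measurable_EFinP/measurable_indic.
    by apply: eq_bigr => j _; rewrite integral_indic// setIT.
  apply: ge0_le_integral => //.
  - by move=> t _; apply: sume_ge0.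
  - apply: emeasurable_sum => j; exact/measurable_EFinP/measurable_indic.
  - exact/measurable_EFinP/measurable_funM.
  - move=> t _; rewrite sumEFin lee_fin.
    have y : 0 <= n%:R * g t <= N.+1%:R by rewrite gN mulr_ge0.
    have /andP[_] := staircase _ _ y; apply: le_trans; apply: ler_sum => j _.
    rewrite indicE; case: (boolP (t \in S j)) => [/set_mem ->//|_].
    exact: ler0n.
move=> le; rewrite -(@lee_pmul2l _ n%:R%:E)// ?lte_fin// ge0_muleDr//.
- rewrite -EFinM addeC; apply: le_trans le _; rewrite leeD2r// -EFinM lee_fin//.
- by apply: integral_ge0 => t _; rewrite lee_fin.
- by rewrite lee_fin ltW.
Qed.

End Integration.

(** * The dual ball in the weak* topology *)

Section Scalars.
Context {R : realType}.

(** The absolute value matters: [powR] sends negative numbers to [1], hence is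
    discontinuous at [0]. *)
Lemma continuous_norm_powR (p : R) :
  0 < p -> continuous (fun y : R => `|y| `^ p).
Proof.
move=> p0 y; have [->|y0] := eqVneq y 0; last first.
  apply: (@continuous_comp _ _ _ (fun y : R => `|y|) (fun z : R => z `^ p)).
    exact: norm_continuous.
  apply: differentiable_continuous; apply/derivable1_diffP.
  by apply: derivable_powR; rewrite in_itv/= andbT normr_gt0.
rewrite /continuous_at normr0 powR0 ?gt_eqF//; apply/cvgrPdist_lt => e e0.
near=> z; rewrite sub0r normrN ger0_norm ?powR_ge0//.
rewrite -[ltRHS]powRr1 ?ltW// -(mulVf (lt0r_neq0 p0)) powRrM.
rewrite gt0_ltr_powR ?nnegrE ?powR_ge0//.
by near: z; apply/(@nbhs0_lt R R)/powR_gt0.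
Unshelve. all: by end_near. Qed.

Context {k : scalar_kind}.
Local Notation K := (scalars R k).

Lemma scalar_re_le (a b : K) : a <= b -> scalar_re a <= scalar_re b.
Proof. by case: k a b => //= a b; rewrite lecE => /andP[]. Qed.

Lemma ge0_scalar_re_le (a b : K) : 0 <= a -> 0 <= b ->
  (scalar_re a <= scalar_re b) = (a <= b).
Proof.
case: k a b => //= -[a a'] [b b']; rewrite !lecE/=.
by move=> /andP[/eqP-> _] /andP[/eqP-> _]; rewrite eqxx.
Qed.

Lemma scalar_reD (a b : K) : scalar_re (a + b) = scalar_re a + scalar_re b.
Proof. by case: k a b => //= -[a a'] [b b']. Qed.

Lemma scalar_re1 : scalar_re (1 : K) = 1.
Proof. by case: k. Qed.

Lemma scalar_re_lt_near (e : R) : 0 < e ->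
  exists2 d : K, 0 < d & forall a : K, a < d -> scalar_re a < e.
Proof.
case: k => /= e0; first by exists e.
exists (e%:C)%C; first by rewrite ltcR.
by move=> a; rewrite ltcE => /andP[].
Qed.

Section rnorm.
Context {V : normedModType K}.
Implicit Types u v : V.

Lemma rnorm_ge0 v : 0 <= rnorm v.
Proof. by rewrite /rnorm -(@scalar_re0 R k) scalar_re_le. Qed.

Lemma rnormD u v : rnorm (u + v) <= rnorm u + rnorm v.
Proof. by rewrite /rnorm -scalar_reD scalar_re_le// ler_normD. Qed.

Lemma continuous_rnorm : continuous (@rnorm R k V).
Proof.
move=> v; apply/cvgrPdist_lt => e e0.
have [d d0 de] := scalar_re_lt_near e e0.
have near_v : \forall u \near v, `|v - u| < d.
  exact: (iffLR (cvgrPdist_lt id v) cvg_id).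
near=> u; apply: le_lt_trans (de `|v - u| _); last by near: u.
rewrite -/(rnorm (v - u)) ler_norml; apply/andP; split.
  have := rnormD (u - v) v; rewrite subrK /rnorm distrC; lra.
by have := rnormD (v - u) u; rewrite subrK; lra.
Unshelve. all: by end_near. Qed.

End rnorm.
End Scalars.

Lemma rnorm_le {R : realType} {k : scalar_kind}
  {V W : normedModType (scalars R k)} (v : V) (w : W) :
  (rnorm v <= rnorm w) = (`|v| <= `|w|).
Proof. exact: ge0_scalar_re_le. Qed.

Section Discs.
Context {R : realType}.

Lemma compact_real_disc (r : R) : compact [set z : R^o | `|z| <= r].
Proof.
rewrite (_ : [set z | _] = `[- r, r]%classic); first exact: segment_compact.
by apply/seteqP; split=> z /=; rewrite in_itv/= ler_norml.
Qed.

Lemma continuous_complex_of_pair :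
  continuous (fun ab : R^o * R^o => (ab.1 +i* ab.2)%C : R[i]^o).
Proof.
move=> [a b]; apply/cvgrPdist_lt => e e0.
have [e' e'0 ee'] : exists2 e' : R, 0 < e' & e = (e'%:C)%C.
  case: e e0 => e e'; rewrite ltcE/= => /andP[/eqP-> e0]; by exists e.
have h0 : 0 < e' / 2 by rewrite divr_gt0.
have fstP : \forall cd \near ((a, b) : R^o * R^o), `|a - cd.1| < e' / 2.
  exact: (iffLR (cvgrPdist_lt _ _) (@cvg_fst R^o R^o (nbhs a) (nbhs b) _) _ h0).
have sndP : \forall cd \near ((a, b) : R^o * R^o), `|b - cd.2| < e' / 2.
  exact: (iffLR (cvgrPdist_lt _ _) (@cvg_snd R^o R^o (nbhs a) (nbhs b) _) _ h0).
near=> cd; rewrite ee' normc_def/= ltcR.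
have : `|a - cd.1| < e' / 2 by near: cd.
have : `|b - cd.2| < e' / 2 by near: cd.
rewrite !ltr_norml => /andP[b1 b2] /andP[a1 a2].
rewrite -[ltRHS](ger0_norm (ltW e'0)) -sqrtr_sqr ltr_sqrt ?exprn_gt0//.
by nra.
Unshelve. all: by end_near. Qed.

(** The disc is closed, and contained in the image of a compact square of the
    real plane. *)
Lemma compact_complex_disc (r : R[i]) : compact [set z : R[i]^o | `|z| <= r].
Proof.
have [r0|rN] := boolP (0 <= r); last first.
  rewrite (_ : [set z | _] = set0); first exact: compact0.
  by rewrite -subset0 => z /= zr; move/negP : rN; apply; exact: le_trans zr.
have discE : [set z : R[i]^o | `|z| <= r] =
    @rnorm R ComplexScalars R[i]^o @^-1`
      [set y | y <= scalar_re (r : scalars R ComplexScalars)].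
  apply/seteqP; split=> z;
    by rewrite /preimage/mkset /rnorm (@ge0_scalar_re_le R ComplexScalars).
pose box : set (R^o * R^o) := `[- complex.Re r, complex.Re r]%classic `*`
                              `[- complex.Re r, complex.Re r]%classic.
apply: (@subclosed_compact _ _
  ((fun ab : R^o * R^o => (ab.1 +i* ab.2)%C : R[i]^o) @` box)).
- rewrite discE.
  exact: (iffLR (continuous_closedP _)
    (@continuous_rnorm R ComplexScalars R[i]^o) _ (@closed_le _ _)).
- apply: continuous_compact; last first.
    by apply: compact_setX; exact: segment_compact.
  exact/continuous_subspaceT/continuous_complex_of_pair.
- move=> [a b]/= ab; exists (a, b) => //=.
  have r'0 : 0 <= complex.Re r by move: r0; rewrite lecE => /andP[].
  move: ab; rewrite normc_def lecE/= => /andP[_ ab].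
  have s0 := sqrtr_ge0 (a ^+ 2 + b ^+ 2).
  have abr : a ^+ 2 + b ^+ 2 <= complex.Re r ^+ 2.
    rewrite -(sqr_sqrtr (addr_ge0 (sqr_ge0 a) (sqr_ge0 b))).
    by rewrite ler_pXn2r.
  split; rewrite /= in_itv/= -ler_norml -(@ler_pXn2r _ 2)//;
    by rewrite real_normK ?num_real//; nra.
Qed.

End Discs.

Lemma compact_disc (R : realType) (k : scalar_kind) (r : scalars R k) :
  compact [set z : (scalars R k)^o | `|z| <= r].
Proof.
by case: k r => r; [exact: compact_real_disc | exact: compact_complex_disc].
Qed.

Section WeakStar.
Context {R : realType} {k : scalar_kind}.
Context {E : completeNormedModType (scalars R k)}.
Local Notation K := (scalars R k).

Lemma continuous_affine_defect (X : topologicalType) (f g h : X -> K^o)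
    (a : K) :
  continuous f -> continuous g -> continuous h ->
  continuous (fun t => f t - (a *: g t + h t)).
Proof.
move=> cf cg ch t; apply: cvgB; first exact: cf.
by apply: cvgD; [apply: cvgZ; [exact: cvg_cst | exact: cg] | exact: ch].
Qed.

(** Described by pointwise conditions, without continuity and without the
    supremum of the dual norm, the ball can be seen to be closed for pointwise
    convergence. *)
Lemma dual_ballE : @dual_ball R k E =
  [set phi | (forall x, `|phi x| <= `|x|) /\ linear (phi : E -> K^o)]
    :> set {ptws E -> K^o}.
Proof.
apply/seteqP; split=> phi.
- move=> [[lphi cphi] phi1]; split=> // x.
  have phi0 : phi 0 = 0.
    by have := lphi (-1) 0 0; rewrite scaleN1r oppr0 addr0 scaleN1r addNr.
  have [->|x0] := eqVneq x 0; first by rewrite phi0 !normr0.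
  have nx0 : `|x| != 0 by rewrite normr_eq0.
  pose y := `|x|^-1 *: x.
  have y1 : `|y| = 1 by rewrite normrZ normfV normr_id mulVf.
  have : ((rnorm (phi y))%:E <= 1)%E.
    apply: le_trans phi1.
    by apply: ereal_sup_ubound; exists y => //=; rewrite /rnorm y1 scalar_re1.
  rewrite lee_fin /rnorm -(@scalar_re1 R k) ge0_scalar_re_le//.
  have := lphi `|x|^-1 x 0; rewrite !addr0 phi0 addr0 => ->.
  by rewrite normrZ normfV normr_id ler_pdivrMl ?mulr1// normr_gt0.
- move=> [phi1 lphi]; split; last first.
    apply: ge_ereal_sup => _ [x x1 <-]; rewrite lee_fin.
    by apply: le_trans x1; rewrite rnorm_le.
  split=> // x; apply/cvgrPdist_lt => e e0.
  have near_x : \forall y \near x, `|x - y| < e.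
    exact: (iffLR (cvgrPdist_lt id x) cvg_id).
  near=> y; have -> : phi x - phi y = phi (x - y).
    have := lphi (-1) y x; rewrite !scaleN1r (addrC (- y)) => ->.
    by rewrite addrC.
  by apply: le_lt_trans (phi1 _) _; near: y.
Unshelve. all: by end_near. Qed.

(** The Banach-Alaoglu theorem: the dual ball is a closed part of the product
    over [x] of the discs of radius [`|x|], which is compact by Tychonoff's
    theorem. *)
Lemma compact_dual_ball : compact (@dual_ball R k E).
Proof.
have -> : @dual_ball R k E =
    [set phi | forall x, [set z : K^o | `|z| <= `|x| ] (phi x)] `&`
    [set phi | linear (phi : E -> K^o)] :> set {ptws E -> K^o}.
  by rewrite dual_ballE.
apply: compact_closedI.
  apply: (@tychonoff E (fun=> K^o) (fun x => [set z | `|z| <= `|x| ])) => x.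
  exact: compact_disc.
have cev z : continuous (fun phi : {ptws E -> K^o} => phi z).
  exact: (@proj_continuous E (fun=> K^o) z).
pose defect (axy : K * E * E) (phi : {ptws E -> K^o}) : K^o :=
  phi (axy.1.1 *: axy.1.2 + axy.2) - (axy.1.1 *: phi axy.1.2 + phi axy.2).
rewrite (_ : [set phi | _] =
  \bigcap_axy (defect axy @^-1` [set 0])); last first.
  apply/seteqP; split=> phi lphi => [[[a x] y] _|a x y].
    by rewrite /= /defect/= lphi subrr.
  by have /eqP := lphi (a, x, y) I; rewrite subr_eq0 => /eqP.
apply: closed_bigI => -[[a x] y] _.
apply: (iffLR (continuous_closedP _) _ [set 0]); last first.
  apply: accessible_closed_set1; apply: hausdorff_accessible.
  exact: norm_hausdorff.
exact: continuous_affine_defect (cev _) (cev _) (cev _).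
Qed.

Lemma compact_weakstar_ball : compact [set: weakstar_ball E].
Proof.
move=> F FF _.
have FB : (@set_val _ (@dual_ball R k E) @ F) (@dual_ball R k E).
  apply: (@filterS _ F _ setT) filterT => -[phi phiB] _.
  exact: (set_mem phiB).
have [f [fB clf]] := compact_dual_ball _ (fmap_proper_filter _ _) FB.
exists (SigSub (mem_set fB)); split=> // A B FA.
rewrite nbhsE => -[U [[V oV <-] Vf] VB].
have [||_ [[phi Aphi <-] Vphi]] := clf (@set_val _ (@dual_ball R k E) @` A) V.
- by apply: (@filterS _ F _ A) FA => phi Aphi; exists phi.
- exact: open_nbhs_nbhs (conj oV Vf).
- by exists phi; split=> //; exact: VB.
Qed.

Lemma continuous_dual_eval (x : E) :
  continuous (fun phi : weakstar_ball E => dual_eval phi x).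
Proof.
move=> phi.
apply: (@continuous_comp _ _ _ (@set_val _ (@dual_ball R k E))
  (fun psi : {ptws E -> K^o} => psi x)).
  exact: initial_continuous.
exact: (@proj_continuous E (fun=> K^o) x).
Qed.

Lemma hausdorff_weakstar_ball : hausdorff_space (weakstar_ball E).
Proof.
move=> phi psi cl; apply/val_inj/funext => x.
apply: (@norm_hausdorff _ K^o) => A B nA nB.
have := cl _ _ (continuous_dual_eval x phi _ nA)
  (continuous_dual_eval x psi _ nB).
by move=> [chi [? ?]]; exists (dual_eval chi x).
Qed.

End WeakStar.

(** * The domination theorem *)

Section Evaluation.
Context {R : realType} {k : scalar_kind}.
Context {E : completeNormedModType (scalars R k)}.
Context {p : R} (p0 : 0 < p).

Definition eval_powR (x : E) (phi : weakstar_ball E) : R :=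
  rnorm (dual_eval phi x) `^ p.

Lemma eval_powR_bound x phi : 0 <= eval_powR x phi <= rnorm x `^ p.
Proof.
rewrite /eval_powR powR_ge0/=.
apply: (ge0_ler_powR (ltW p0)); rewrite ?nnegrE ?rnorm_ge0//.
have le_norm psi : @dual_ball R k E psi -> `|psi x| <= `|x|.
  by rewrite dual_ballE => -[].
by rewrite rnorm_le; case: phi => psi psiB; exact: le_norm (set_mem psiB).
Qed.

Lemma continuous_eval_powR x : continuous (eval_powR x).
Proof.
rewrite (_ : eval_powR x =
  fun phi => `|rnorm (dual_eval phi x)| `^ p); last first.
  by apply/funext => phi; rewrite ger0_norm ?rnorm_ge0.
move=> phi; apply: (@continuous_comp _ _ _
  (fun phi : weakstar_ball E => rnorm (dual_eval phi x))
  (fun y : R => `|y| `^ p)); last exact: continuous_norm_powR.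
apply: (@continuous_comp _ _ _
  (fun phi : weakstar_ball E => dual_eval phi x)).
  exact: continuous_dual_eval.
exact: continuous_rnorm.
Qed.

Lemma sum_eval_powR_has_ub {I : Type} (s : seq I) (x : I -> E) :
  has_ubound (range (fun phi => \sum_(i <- s) eval_powR (x i) phi)).
Proof.
exists (\sum_(i <- s) rnorm (x i) `^ p) => _ [phi _ <-].
by apply: ler_sum => i _; have /andP[] := eval_powR_bound (x i) phi.
Qed.

Lemma ereal_sup_sum_eval_powR {I : Type} (s : seq I) (x : I -> E) :
  ereal_sup [set (\sum_(i <- s) eval_powR (x i) phi)%:E
            | phi in [set: weakstar_ball E]] =
  (sup (range (fun phi => \sum_(i <- s) eval_powR (x i) phi)))%:E.
Proof.
rewrite -ereal_sup_EFin; first by rewrite image_comp.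
- exact: sum_eval_powR_has_ub.
- by exists (\sum_(i <- s) eval_powR (x i) point), point.
Qed.

End Evaluation.
Arguments eval_powR {R k E} p x phi.

Theorem theorem4p2 (R : realType) (k : scalar_kind)
    (E F : completeNormedModType (scalars R k)) (p : R) (hp : 0 < p)
    (f : E -> F) (a : E) :
  absolutely_summing_at p f a <->
  exists (C : R) (mu : probability (weakstar_borel E) R),
    [/\ 0 < C, regular_borel mu &
     forall x : E,
       ((rnorm (f (a + x) - f a))%:E <=
        C%:E * (\int[mu]_(phi in [set: weakstar_borel E])
                  (rnorm (dual_eval phi x) `^ p)%:E) `^ p^-1)%E].
Proof.
pose N x := rnorm (f (a + x) - f a).
have N0 x : 0 <= N x by exact: rnorm_ge0.
have q0 : 0 < p^-1 by rewrite invr_gt0.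
split=> [[C C0 summing]|[C [mu [C0 _ dom]]]].
- (* [C] may vanish, whereas the bound has to be divided by the constant. *)
  pose C1 := Num.max C 1.
  have C1_gt0 : 0 < C1 by rewrite lt_max ltr01 orbT.
  pose c x := N x `^ p / C1.
  have c0 x : 0 <= c x by rewrite divr_ge0 ?powR_ge0 ?ltW.
  have g0 (x : E) phi : 0 <= eval_powR p x phi.
    by have /andP[] := eval_powR_bound hp x phi.
  have bg (x : E) : exists M, forall phi, eval_powR p x phi <= M.
    by exists (rnorm x `^ p) => phi; have /andP[] := eval_powR_bound hp x phi.
  have le_sup (s : seq E) : \sum_(x <- s) c x <=
      sup (range (fun phi => \sum_(x <- s) eval_powR p x phi)).
    set S := sup _.
    have S0 : 0 <= S.
      apply: (@le_trans _ _ (\sum_(x <- s) eval_powR p x point)).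
        exact: sumr_ge0.
      apply: ub_le_sup; last by exists point.
      exact: (sum_eval_powR_has_ub hp s id).
    have [s0|s0] := posnP (size s).
      by rewrite (size0nil s0) big_nil in S0 *.
    have := summing (size s) (fun j => tnth (in_tuple s) j) s0.
    have -> : ereal_sup
        [set (\sum_(j < size s)
                 rnorm (dual_eval phi (tnth (in_tuple s) j)) `^ p)%:E
        | phi in [set: weakstar_ball E]] = S%:E.
      rewrite -(ereal_sup_sum_eval_powR hp s id); congr ereal_sup.
      by apply: eq_imagel => phi _; rewrite [in RHS]big_tnth.
    rewrite -EFinM lee_fin -mulr_suml ler_pdivrMr// [in X in _ -> X]big_tnth.
    move=> /le_trans; apply.
    by rewrite mulrC ler_wpM2l// le_max lexx.
  have [nu nuP nuc] := dominating_content _ _ g0 bg c0 le_sup.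
  have [mu [outer inner nu_mu]] :=
    content_regular_probability hausdorff_weakstar_ball
      compact_weakstar_ball nuP.
  exists (C1 `^ p^-1), mu; split=> [|A mA|x]; first exact: powR_gt0.
    by split; [exact: outer | exact: inner].
  have cx : ((c x)%:E <= \int[mu]_phi (eval_powR p x phi)%:E)%E.
    apply: (le_integral_of_level_sets mu _ _ _ (continuous_eval_powR hp x)
      (eval_powR_bound hp x)) => n M n0 gM.
    have := nuc x n M n0 gM.
    rewrite -lee_fin => /le_trans; apply; rewrite EFinD leeD2l// -sumEFin.
    apply: lee_sum => j _; apply: nu_mu; apply: closed_level_set.
    exact: continuous_eval_powR.
  have N_eq : N x = C1 `^ p^-1 * (c x) `^ p^-1.
    rewrite -powRM ?(ltW C1_gt0)// [C1 * _]mulrC divfK ?gt_eqF//.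
    by rewrite -powRrM mulfV ?gt_eqF// powRr1.
  rewrite -/(N x) N_eq EFinM lee_pmul2l ?lte_fin ?powR_gt0//.
  rewrite -poweR_EFin; apply: gt0_ler_poweR => //; first exact: ltW.
    by rewrite in_itv/= leey andbT lee_fin.
  rewrite in_itv/= leey andbT; apply: integral_ge0 => phi _.
  by rewrite lee_fin powR_ge0.
- exists (C `^ p); first exact: powR_ge0.
  move=> m x _.
  pose I y :=
    (\int[mu]_(phi in [set: weakstar_borel E]) (eval_powR p y phi)%:E)%E.
  have mg y : measurable_fun setT
      (fun phi : weakstar_borel E => (eval_powR p y phi)%:E).
    apply/measurable_EFinP; apply: continuous_borel_measurable.
    exact: continuous_eval_powR.
  have NI y : ((N y `^ p)%:E <= (C `^ p)%:E * I y)%E.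
    have I0 : (0 <= I y)%E.
      by apply: integral_ge0 => phi _; rewrite lee_fin powR_ge0.
    have C_ge0 : (0 <= C%:E)%E by rewrite lee_fin ltW.
    rewrite -!poweR_EFin -[in leRHS](poweRe1 I0) -(mulVf (lt0r_neq0 hp)).
    rewrite poweRrM -poweRM ?poweR_ge0//; apply: gt0_ler_poweR; last exact: dom.
    - exact: ltW.
    - by rewrite in_itv/= leey andbT lee_fin.
    - by rewrite in_itv/= leey andbT mule_ge0// poweR_ge0.
  set S := ereal_sup _.
  apply: (@le_trans _ _ ((C `^ p)%:E * \sum_(j < m) I (x j))%E).
    rewrite ge0_sume_distrr; last first.
      by move=> j _; apply: integral_ge0 => phi _; rewrite lee_fin powR_ge0.
    by rewrite -sumEFin; apply: lee_sum => j _; exact: NI.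
  rewrite lee_pmul2l ?lte_fin ?powR_gt0//.
  have g0 (y : E) phi : (0 <= (eval_powR p y phi)%:E)%E.
    by rewrite lee_fin powR_ge0.
  rewrite -(ge0_integral_sum mu measurableT (fun j => mg (x j)))//.
  have muT : (\int[mu]_(phi in [set: weakstar_borel E]) (cst S phi) = S)%E.
    by rewrite integral_cst// [X in (_ * X)%E]probability_setT mule1.
  have le_S phi : (\sum_(j < m) (eval_powR p (x j) phi)%:E <= S)%E.
    by rewrite sumEFin; apply: ereal_sup_ubound; exists phi.
  rewrite -[leRHS]muT; apply: ge0_le_integral => //.
  - by move=> phi _; apply: sume_ge0.
  - by apply: emeasurable_sum => j; exact: mg.
Qed.
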